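(* Let $(A,\circ,P)$ be a Rota-Baxter pre-Lie algebra of weight zero with its sub-adjacent Rota-Baxter Lie algebra $(\mathfrak{g}(A),P)$. Let $[-,-]$ be the bracket of the Lie algebra $\mathfrak{g}(A)\ltimes_{\mathcal{L}_{\circ}^{*}}A^{*}$, and let $\delta=\delta_r$ be defined by $\delta_r(a)=(\mathrm{ad}(a)\otimes\mathrm{id}+\mathrm{id}\otimes\mathrm{ad}(a))r$ for $a\in\mathfrak{g}(A)\ltimes_{\mathcal{L}_{\circ}^{*}}A^{*}$, with $r=\sum_{i=1}^{n}(e_{i}\otimes e^{*}_{i}-e^{*}_{i}\otimes e_{i})$, where $\{e_1,\cdots,e_n\}$ is a basis of $A$ and $\{e_1^*,\cdots,e_n^*\}$ is the dual basis. Then there are two special L-dendriform bialgebras $(\mathfrak{g}(A)\ltimes_{\mathcal{L}_{\circ}^{*}}A^{*},\triangleright_1,\triangleleft_1,\Delta_1,\nabla_1)$ and $(\mathfrak{g}(A)\ltimes_{\mathcal{L}_{\circ}^{*}}A^{*},\triangleright_2,\triangleleft_2,\Delta_2,\nabla_2)$, where for all $a,b\in\mathfrak{g}(A)\ltimes_{\mathcal{L}_{\circ}^{*}}A^{*}$: $$a\triangleleft_1 b=-(-P+P^{*})([a,b]),\quad a\triangleright_1 b=[(P-P^{*})a,b]+(-P+P^{*})[a,b],$$ $$\nabla_1(a)=-\delta((P-P^{*})a),\quad \Delta_1(a)=((-P+P^{*})\otimes\mathrm{id})\delta(a)+\delta((P-P^{*})a),$$ $$a\triangleleft_{2} b=-P^{*}([a,b]),\quad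 a\triangleright_{2} b=[P(a),b]+P^{*}([a,b]),$$ $$\nabla_2(a)=-\delta(P(a)),\quad \Delta_2(a)=(P^{*}\otimes\mathrm{id})\delta(a)+\delta(P(a)).$$
   Context: All vector spaces and algebras are finite-dimensional over a field of characteristic zero; $\tau$ is the flip. A pre-Lie algebra is $(A,\circ)$ with $(x\circ y)\circ z-x\circ(y\circ z)=(y\circ x)\circ z-y\circ(x\circ z)$; its sub-adjacent Lie algebra $\mathfrak g(A)$ is $A$ with bracket $x\circ y-y\circ x$. A Rota-Baxter pre-Lie algebra of weight zero is $(A,\circ,P)$ with $P$ linear and $P(x)\circ P(y)=P(P(x)\circ y)+P(x\circ P(y))$; then $P$ is a Rota-Baxter operator of weight zero on $\mathfrak g(A)$. $\mathcal L_\circ^*:A\to\mathrm{End}(A^* )$ is given by $\langle\mathcal L_\circ^*(x)a^*,y\rangle=-\langle a^*,x\circ y\rangle$. $\mathfrak g(A)\ltimes_{\mathcal L_\circ^*}A^*$ is the Lie algebra $A\oplus A^*$ with $[x+a^*,y+b^*]=(x\circ y-y\circ x)+\mathcal L_\circ^*(x)b^*-\mathcal L_\circ^*(y)a^*$. $P^*$ is the transpose of $P$; $P-P^*$ denotes $x+a^*\mapsto P(x)-P^*(a^* )$, $-P+P^*$ its negative; $P$ (resp. $P^*$) alone is extended by zero on $A^*$ (resp. $A$). An L-dendriform algebra $(V,\triangleright,\triangleleft)$ satisfies $(x\triangleright y)\triangleright z+(x\triangleleft y)\triangleright z+y\triangleright(x\triangleright z)-(y\triangleleft x)\triangleright z-(y\triangleright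 x)\triangleright z-x\triangleright(y\triangleright z)=0$ and $(x\triangleright y)\triangleleft z+y\triangleleft(x\triangleright z)+y\triangleleft(x\triangleleft z)-(y\triangleleft x)\triangleleft z-x\triangleright(y\triangleleft z)=0$; it is special if $\triangleleft$ is antisymmetric. A special L-dendriform coalgebra is $(V,\Delta,\nabla)$ with $\nabla=-\tau\nabla$ and, with $\Diamond=\Delta+\nabla$: $(\mathrm{id}\otimes\nabla)\nabla+(\tau\otimes\mathrm{id})(\mathrm{id}\otimes\Diamond)\nabla+(\Diamond\otimes\mathrm{id})\nabla-(\mathrm{id}\otimes\nabla)\Diamond=0$, $(\Diamond\otimes\mathrm{id})\Diamond-(\mathrm{id}\otimes\Diamond)\Diamond=(\tau\otimes\mathrm{id})(\Diamond\otimes\mathrm{id})\Diamond-(\tau\otimes\mathrm{id})(\mathrm{id}\otimes\Diamond)\Diamond$. A special L-dendriform bialgebra $(V,\triangleright,\triangleleft,\Delta,\nabla)$ consists of a special L-dendriform algebra and a special L-dendriform coalgebra such that, with $\Diamond=\Delta+\nabla$, $x\diamond y=x\triangleright y+x\triangleleft y$, $[x,y]_\diamond=x\diamond y-y\diamond x$, $\mathcal{L}_{\cdot}(x)y=x\cdot y$, $\mathcal{R}_{\cdot}(y)x=x\cdot y$, for all $x,y\in V$: $\Diamond(x\diamond y)-(\mathrm{id}\otimes\mathcal{R}_{\diamond}(y))\Delta(x)+(\mathcal{L}_{\triangleleft}(y)\otimes\mathrm{id})\nabla(x)-(\mathcal{L}_{\triangleright}(x)\otimes\mathrm{id}+\mathrm{id}\otimes\mathcal{L}_{\diamond}(x))\Diamond(y)=0$,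 $(\tau-\mathrm{id})\big((\mathrm{id}\otimes\mathcal{L}_{\triangleleft}(x))\Diamond(y)-(\mathrm{id}\otimes\mathcal{L}_{\triangleleft}(y))\Diamond(x)-\Diamond(x\triangleleft y)\big)=0$, $\nabla([x,y]_\diamond)+(\mathcal{L}_{\diamond}(y)\otimes\mathrm{id}+\mathrm{id}\otimes\mathcal{L}_{\diamond}(y))\nabla(x)-(\mathcal{L}_{\diamond}(x)\otimes\mathrm{id}+\mathrm{id}\otimes\mathcal{L}_{\diamond}(x))\nabla(y)=0$. *)

(* Defs.v *)
From HB Require Import structures.
From mathcomp Require Import all_boot all_order all_algebra.

Set Implicit Arguments.
Unset Strict Implicit.
Unset Printing Implicit Defensive.

Import GRing.Theory.
Local Open Scope ring_scope.

Definition is_bilinear (F : fieldType) (U V W : vectType F)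
    (f : U -> V -> W) : Prop :=
  (forall v, linear (f^~ v)) /\ (forall u, linear (f u)).

(* Tensor product of finite-dimensional spaces, realised as the space of
   coordinate matrices with respect to the library's chosen bases
   [vbasis fullv].  Elements are only built through [tens] (written u ⊗ v) and
   maps out of it only through [tlift]; the lemmas [tens_bilinear],
   [tlift_linear], [tlift_tens] and [tensor_ext] give the universal property,
   so the choice of bases is immaterial. *)
Definition tensor (F : fieldType) (U V : vectType F) : vectType F :=
  'M[F]_(\dim {: U}, \dim {: V}).

Definition tens (F : fieldType) (U V : vectType F) (u : U) (v : V)
    : tensor U V :=
  \matrix_(i, j) (coord (vbasis {: U}) i u * coord (vbasis {: V}) j v).

Notation "u ⊗ v" := (tens u v) (at level 38, left associativity) : ring_scope.

(* The linear map U ⊗ V -> W induced by a bilinear map U x V -> W. *)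
Definition tlift (F : fieldType) (U V W : vectType F) (f : U -> V -> W)
    (t : tensor U V) : W :=
  \sum_i \sum_j t i j *: f (vbasis {: U})`_i (vbasis {: V})`_j.

(* f ⊗ g, meaningful for linear f and g. *)
Definition tmap (F : fieldType) (U U' V V' : vectType F)
    (f : U -> U') (g : V -> V') : tensor U V -> tensor U' V' :=
  tlift (fun u v => f u ⊗ g v).

Definition tflip (F : fieldType) (U V : vectType F)
    : tensor U V -> tensor V U :=
  tlift (fun u v => v ⊗ u).

Definition tassoc (F : fieldType) (U V W : vectType F)
    : tensor (tensor U V) W -> tensor U (tensor V W) :=
  tlift (fun s w => tlift (fun u v => u ⊗ (v ⊗ w)) s).

(* tau ⊗ id on triple tensors; these are bracketed to the right throughout. *)
Definition tflip12 (F : fieldType) (V : vectType F)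
    : tensor V (tensor V V) -> tensor V (tensor V V) :=
  tlift (fun u => tlift (fun v w => v ⊗ (u ⊗ w))).

Section TensorTheory.
Variables (F : fieldType).
Implicit Types U V W : vectType F.

Lemma tens_bilinear U V : is_bilinear (@tens F U V).
Proof.
split=> [v a x y | u a x y]; apply/matrixP=> i j.
  by rewrite !mxE linearP /= mulrDl mulrA.
by rewrite !mxE linearP /= mulrDr mulrCA.
Qed.

Lemma tlift_linear U V W (f : U -> V -> W) : linear (tlift f).
Proof.
move=> a s t; rewrite /tlift scaler_sumr -big_split /=.
apply: eq_bigr => i _; rewrite scaler_sumr -big_split /=.
by apply: eq_bigr => j _; rewrite !mxE scalerDl scalerA.
Qed.

Lemma linear_sum U W (f : U -> W) (I : finType) (c : I -> F) (x : I -> U) :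
  linear f -> f (\sum_i c i *: x i) = \sum_i c i *: f (x i).
Proof.
move=> lf; have f0 : f 0 = 0.
  have := lf 1 0 0; rewrite !scale1r addr0 => /(congr1 (fun z => z - f 0)).
  by rewrite subrr addrK.
elim/big_rec2: _ => [|i y1 y2 _ <-]; first exact: f0.
exact: lf.
Qed.

Lemma tlift_tens U V W (f : U -> V -> W) u v :
  is_bilinear f -> tlift f (u ⊗ v) = f u v.
Proof.
move=> [fl fr].
rewrite {2}(coord_vbasis (memvf u)) (linear_sum _ _ (fl v)).
apply: eq_bigr => i _.
rewrite {2}(coord_vbasis (memvf v)) (linear_sum _ _ (fr _)) scaler_sumr.
by apply: eq_bigr => j _; rewrite mxE scalerA.
Qed.

Lemma tensor_ext U V W (f g : tensor U V -> W) :
  linear f -> linear g -> (forall u v, f (u ⊗ v) = g (u ⊗ v)) -> f =1 g.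
Proof.
move=> lf lg fg t.
have -> : t = \sum_p t p.1 p.2 *: ((vbasis {: U})`_p.1 ⊗ (vbasis {: V})`_p.2).
  rewrite -(pair_bigA _ (fun i j =>
    t i j *: ((vbasis {: U})`_i ⊗ (vbasis {: V})`_j))) /=.
  rewrite {1}(matrix_sum_delta t); apply: eq_bigr => i _.
  apply: eq_bigr => j _; congr (_ *: _); apply/matrixP=> k l.
  by rewrite !mxE !coord_free ?(basis_free (vbasisP _)) //
     -natrM mulnb !(eq_sym k, eq_sym l).
rewrite (linear_sum _ _ lf) (linear_sum _ _ lg).
by apply: eq_bigr => p _; rewrite fg.
Qed.

Lemma tmap_tens (U U' V V' : vectType F) (f : U -> U') (g : V -> V') u v :
  linear f -> linear g -> tmap f g (u ⊗ v) = f u ⊗ g v.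
Proof.
move=> lf lg; apply: tlift_tens; have [tl tr] := tens_bilinear U' V'.
by split=> [y a x z | x a y z]; rewrite ?lf ?lg ?tl ?tr.
Qed.

Lemma tflip_tens U V (u : U) (v : V) : tflip (u ⊗ v) = v ⊗ u.
Proof.
by apply: tlift_tens; have [tl tr] := tens_bilinear V U; split=> w a x y;
  rewrite ?tl ?tr.
Qed.

Lemma tassoc_tens U V W (u : U) (v : V) (w : W) :
  tassoc ((u ⊗ v) ⊗ w) = u ⊗ (v ⊗ w).
Proof.
have [tl tr] := tens_bilinear U (tensor V W).
have [sl sr] := tens_bilinear V W.
rewrite /tassoc tlift_tens; last first.
  split=> [x | s a x y]; first exact: tlift_linear.
  rewrite /tlift scaler_sumr -big_split /=; apply: eq_bigr => i _.
  rewrite scaler_sumr -big_split /=; apply: eq_bigr => j _.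
  by rewrite sr tr scalerDr !scalerA mulrC.
by rewrite tlift_tens //; split=> [y a x z | x a y z]; rewrite ?sl ?tl ?tr.
Qed.

Lemma tflip12_tens V (u v w : V) : tflip12 (u ⊗ (v ⊗ w)) = v ⊗ (u ⊗ w).
Proof.
have [tl tr] := tens_bilinear V (tensor V V).
have [sl sr] := tens_bilinear V V.
rewrite /tflip12 tlift_tens; last first.
  split=> [t a x y | x]; last exact: tlift_linear.
  rewrite /tlift scaler_sumr -big_split /=; apply: eq_bigr => i _.
  rewrite scaler_sumr -big_split /=; apply: eq_bigr => j _.
  by rewrite sl tr scalerDr !scalerA mulrC.
by rewrite tlift_tens //; split=> [y a x z | x a y z]; rewrite ?sr ?tl ?tr.
Qed.

End TensorTheory.

Record is_pre_Lie (F : fieldType) (A : vectType F) (circ : A -> A -> A)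
    : Prop := IsPreLie {
  pre_Lie_bilinear : is_bilinear circ;
  pre_Lie_axiom : forall x y z,
    circ (circ x y) z - circ x (circ y z) =
    circ (circ y x) z - circ y (circ x z) }.

Definition sub_adjacent (F : fieldType) (A : vectType F)
    (circ : A -> A -> A) (x y : A) : A := circ x y - circ y x.

Record is_Rota_Baxter_pre_Lie (F : fieldType) (A : vectType F)
    (circ : A -> A -> A) (P : 'End(A)) : Prop := IsRotaBaxterPreLie {
  Rota_Baxter_pre_Lie : is_pre_Lie circ;
  Rota_Baxter_axiom : forall x y,
    circ (P x) (P y) = P (circ (P x) y) + P (circ x (P y)) }.

Record is_L_dendriform (F : fieldType) (V : vectType F)
    (tr tl : V -> V -> V) : Prop := IsLDendriform {
  tr_bilinear : is_bilinear tr;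
  tl_bilinear : is_bilinear tl;
  L_dendriform_axiom1 : forall x y z,
    tr (tr x y) z + tr (tl x y) z + tr y (tr x z)
    - tr (tl y x) z - tr (tr y x) z - tr x (tr y z) = 0;
  L_dendriform_axiom2 : forall x y z,
    tl (tr x y) z + tl y (tr x z) + tl y (tl x z)
    - tl (tl y x) z - tr x (tl y z) = 0 }.

Record is_special_L_dendriform (F : fieldType) (V : vectType F)
    (tr tl : V -> V -> V) : Prop := IsSpecialLDendriform {
  special_L_dendriform : is_L_dendriform tr tl;
  tl_antisymmetric : forall x y, tl x y = - tl y x }.

Record is_special_L_dendriform_coalgebra (F : fieldType) (V : vectType F)
    (Delta Nabla : V -> tensor V V) : Prop := IsSpecialLDendriformCoalgebra {
  Delta_linear : linear Delta;
  Nabla_linear : linear Nabla;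
  Nabla_antisymmetric : forall x, Nabla x = - tflip (Nabla x);
  coalgebra_axiom1 :
    let Diam x := Delta x + Nabla x in
    forall x,
      tmap id Nabla (Nabla x) + tflip12 (tmap id Diam (Nabla x))
      + tassoc (tmap Diam id (Nabla x)) - tmap id Nabla (Diam x) = 0;
  coalgebra_axiom2 :
    let Diam x := Delta x + Nabla x in
    forall x,
      tassoc (tmap Diam id (Diam x)) - tmap id Diam (Diam x) =
      tflip12 (tassoc (tmap Diam id (Diam x)))
      - tflip12 (tmap id Diam (Diam x)) }.

(* [m y] is the left multiplication L(y), and [m^~ y] the right
   multiplication R(y). *)
Record is_special_L_dendriform_bialgebra (F : fieldType) (V : vectType F)
    (tr tl : V -> V -> V) (Delta Nabla : V -> tensor V V) : Prop :=
  IsSpecialLDendriformBialgebra {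
  bialgebra_algebra : is_special_L_dendriform tr tl;
  bialgebra_coalgebra : is_special_L_dendriform_coalgebra Delta Nabla;
  bialgebra_axiom1 :
    let Diam x := Delta x + Nabla x in
    let diam x y := tr x y + tl x y in
    forall x y,
      Diam (diam x y) - tmap id (diam^~ y) (Delta x) + tmap (tl y) id (Nabla x)
      - (tmap (tr x) id (Diam y) + tmap id (diam x) (Diam y)) = 0;
  bialgebra_axiom2 :
    let Diam x := Delta x + Nabla x in
    forall x y,
      let t := tmap id (tl x) (Diam y) - tmap id (tl y) (Diam x)
               - Diam (tl x y) in
      tflip t - t = 0;
  bialgebra_axiom3 :
    let diam x y := tr x y + tl x y in
    forall x y,
      Nabla (diam x y - diam y x)
      + (tmap (diam y) id (Nabla x) + tmap id (diam y) (Nabla x))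
      - (tmap (diam x) id (Nabla y) + tmap id (diam x) (Nabla y)) = 0 }.

Definition dual_space (F : fieldType) (A : vectType F) : vectType F :=
  'Hom(A, F^o).

Definition Lstar (F : fieldType) (A : vectType F) (circ : A -> A -> A)
    (x : A) (a : dual_space A) : dual_space A :=
  linfun (fun y => - a (circ x y)).

Definition transpose (F : fieldType) (A : vectType F) (P : 'End(A))
    (a : dual_space A) : dual_space A := (a \o P)%VF.

(* The direct sum of A and its dual, underlying the semidirect product. *)
Definition semidirect (F : fieldType) (A : vectType F) : vectType F :=
  (A * dual_space A)%type.

Definition semidirect_bracket (F : fieldType) (A : vectType F)
    (circ : A -> A -> A) (a b : semidirect A) : semidirect A :=
  (sub_adjacent circ a.1 b.1,
   Lstar circ a.1 b.2 - Lstar circ b.1 a.2).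

Definition ext_P (F : fieldType) (A : vectType F) (P : 'End(A))
    (a : semidirect A) : semidirect A := (P a.1, 0).

Definition ext_Pstar (F : fieldType) (A : vectType F) (P : 'End(A))
    (a : semidirect A) : semidirect A := (0, transpose P a.2).

Definition ext_PmPstar (F : fieldType) (A : vectType F) (P : 'End(A))
    (a : semidirect A) : semidirect A := (P a.1, - transpose P a.2).

Definition ext_mPpPstar (F : fieldType) (A : vectType F) (P : 'End(A))
    (a : semidirect A) : semidirect A := (- P a.1, transpose P a.2).

Definition dual_basis (F : fieldType) (A : vectType F) (n : nat)
    (e : n.-tuple A) (i : 'I_n) : dual_space A :=
  linfun (coord e i : A -> F^o).

Definition canonical_r (F : fieldType) (A : vectType F) (n : nat)
    (e : n.-tuple A) : tensor (semidirect A) (semidirect A) :=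
  \sum_(i < n)
    (let ei : semidirect A := (tnth e i, 0) in
     let ei' : semidirect A := (0, dual_basis e i) in
     ei ⊗ ei' - ei' ⊗ ei).

Definition coboundary (F : fieldType) (V : vectType F) (br : V -> V -> V)
    (r : tensor V V) (a : V) : tensor V V :=
  tmap (br a) id r + tmap id (br a) r.

Section DualTheory.
Variables (F : fieldType) (A : vectType F).

Lemma LstarE (circ : A -> A -> A) x (a : dual_space A) y :
  is_bilinear circ -> Lstar circ x a y = - a (circ x y).
Proof.
move=> [_ cr]; pose f y : F^o := - a (circ x y).
have lf : linear f by move=> k u v; rewrite /f cr linearP opprD scalerN.
pose fL := GRing.isLinear.Build F A F^o *:%R f lf.
pose g : {linear A -> F^o} := HB.pack f fL.
exact: (lfunE g y).
Qed.

Lemma dual_basisE n (e : n.-tuple A) i j :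
  basis_of fullv e -> dual_basis e i (tnth e j) = (i == j)%:R.
Proof.
move=> be; rewrite /dual_basis (lfunE (coord e i : {linear A -> F^o})).
by rewrite (tnth_nth 0) /= coord_free ?(basis_free be) // eq_sym.
Qed.

End DualTheory.

(* Main.v *)
(* On V = A + A^* the skew form w(x + a, y + b) = a(y) - b(x) is a symplectic
   2-cocycle, and r is its inverse.  Identifying V with V^* through w turns the
   cobracket delta_r into the Lie bracket of V itself.  In both cases the two
   operators P, Q on V satisfy w(Q u, v) = w(u, P v), the Rota-Baxter identity
   for P, and [P u, Q v] + Q [u, Q v] = Q [P u, v]; hence the coproducts are the
   w-duals of the products, and the coalgebra axioms are the algebra axioms.
   The compatibility conditions follow from delta_r being a 1-cocycle, using
   that P is also Rota-Baxter for the left-symmetric product given by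
   w(u * v, z) = - w(v, [u, z]). *)

Require Import Defs.
From mathcomp Require Import all_boot all_order all_algebra ring.

Set Implicit Arguments.
Unset Strict Implicit.
Unset Printing Implicit Defensive.

Import GRing.Theory.
Local Open Scope ring_scope.

(** * Elementary facts on linear maps *)

Section LinearMaps.
Variables (F : fieldType) (U W : lmodType F) (f : U -> W).
Hypothesis linf : linear f.

Lemma lin0 : f 0 = 0.
Proof. by have := linf (-1) 0 0; rewrite scaler0 addr0 scaleN1r addNr. Qed.

Lemma linD x y : f (x + y) = f x + f y.
Proof. by rewrite -[x]scale1r linf !scale1r. Qed.

Lemma linZ a x : f (a *: x) = a *: f x.
Proof. by rewrite -[a *: x]addr0 linf lin0 addr0. Qed.

Lemma linN x : f (- x) = - f x.
Proof. by rewrite -scaleN1r linZ scaleN1r. Qed.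

End LinearMaps.

Section LinearClosure.
Variables (F : fieldType) (U W : lmodType F).

Lemma linear_id : linear (id : U -> U).
Proof. by []. Qed.

Lemma linear_opp (f : U -> W) : linear f -> linear (fun x => - f x).
Proof. by move=> lf a x y; rewrite lf opprD scalerN. Qed.

Lemma linear_add (f g : U -> W) :
  linear f -> linear g -> linear (fun x => f x + g x).
Proof. by move=> lf lg a x y; rewrite lf lg scalerDr addrACA. Qed.

Lemma linear_comp (X : lmodType F) (f : U -> W) (g : X -> U) :
  linear f -> linear g -> linear (fun x => f (g x)).
Proof. by move=> lf lg a x y; rewrite lg lf. Qed.

End LinearClosure.

(** * Contraction of tensors against a bilinear form *)

Section Contraction.
Variables (F : fieldType) (V : vectType F) (w : V -> V -> F).
Hypothesis w_bil : is_bilinear (w : V -> V -> F^o).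

Lemma wDl x y z : w (x + y) z = w x z + w y z.
Proof. exact: (linD (w_bil.1 z)). Qed.
Lemma wDr x y z : w x (y + z) = w x y + w x z.
Proof. exact: (linD (w_bil.2 x)). Qed.
Lemma wNl x z : w (- x) z = - w x z.
Proof. exact: (linN (w_bil.1 z)). Qed.
Lemma wNr x z : w x (- z) = - w x z.
Proof. exact: (linN (w_bil.2 x)). Qed.
Lemma wZl a x z : w (a *: x) z = a * w x z.
Proof. exact: (linZ (w_bil.1 z)). Qed.
Lemma wZr a x z : w x (a *: z) = a * w x z.
Proof. exact: (linZ (w_bil.2 x)). Qed.
Lemma w0l z : w 0 z = 0.
Proof. exact: (lin0 (w_bil.1 z)). Qed.
Lemma w0r z : w z 0 = 0.
Proof. exact: (lin0 (w_bil.2 z)). Qed.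
Definition wE := (wDl, wDr, wNl, wNr, wZl, wZr).

Definition contr {W : vectType F} (u : V) (t : tensor V W) : W :=
  tlift (fun x s => w u x *: s) t.

Lemma contr_linear (W : vectType F) u : linear (@contr W u).
Proof. exact: tlift_linear. Qed.

Lemma contr_tens (W : vectType F) u x (s : W) : contr u (x ⊗ s) = w u x *: s.
Proof.
rewrite /contr tlift_tens //; split=> [z a y y'|y a z z'].
  by rewrite !wE scalerDl scalerA.
by rewrite scalerDr !scalerA mulrC.
Qed.

Lemma contr0 (W : vectType F) u : contr u (0 : tensor V W) = 0.
Proof. exact: (lin0 (@contr_linear W u)). Qed.

Lemma contrD (W : vectType F) u (s t : tensor V W) :
  contr u (s + t) = contr u s + contr u t.
Proof. exact: (linD (@contr_linear W u)). Qed.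

Lemma contrN (W : vectType F) u (t : tensor V W) :
  contr u (- t) = - contr u t.
Proof. exact: (linN (@contr_linear W u)). Qed.

(** Here [u'] is the value at [u] of the [w]-transpose of [f]. Only this value is asked for, so no
    transposed operator has to be constructed. *)
Lemma contr_tmap (W X : vectType F) (f : V -> V) (g : W -> X) u u' t :
  linear f -> linear g -> (forall x, w u (f x) = w u' x) ->
  contr u (tmap f g t) = g (contr u' t).
Proof.
move=> lf lg uu'; move: t; apply: tensor_ext.
- by apply: linear_comp; [apply: contr_linear | apply: tlift_linear].
- by apply: linear_comp; last exact: contr_linear.
by move=> x s; rewrite tmap_tens // !contr_tens (linZ lg) uu'.
Qed.

Lemma contr_tflip u v (t : tensor V V) :
  w v (contr u (tflip t)) = w u (contr v t).
Proof.
move: t; apply: (tensor_ext (W := F^o)).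
- apply: (linear_comp (f := w v : V -> F^o)); first exact: w_bil.2.
  by apply: linear_comp; [apply: contr_linear | apply: tlift_linear].
- by apply: (linear_comp (f := w u : V -> F^o));
    [apply: w_bil.2 | apply: contr_linear].
by move=> x s; rewrite tflip_tens !contr_tens !wE mulrC.
Qed.

Lemma contr_tflip12 u v (t : tensor V (tensor V V)) :
  contr v (contr u (tflip12 t)) = contr u (contr v t).
Proof.
have lc a b : linear (fun s : tensor V (tensor V V) => contr a (contr b s)).
  by apply: linear_comp; apply: contr_linear.
move: t; apply: tensor_ext.
- by apply: (linear_comp (lc v u)); apply: tlift_linear.
- exact: lc.
move=> x; apply: tensor_ext.
- apply: (linear_comp (lc v u)).
  apply: (linear_comp (f := @tflip12 F V)); first exact: tlift_linear.
  exact: (tens_bilinear _ _).2.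
- by apply: (linear_comp (lc u v)); apply: (tens_bilinear _ _).2.
move=> y z; rewrite tflip12_tens !contr_tens.
by rewrite !(linZ (@contr_linear _ _)) !contr_tens !scalerA mulrC.
Qed.

(** [z] stands for the product of [u] and [v] dual to [D]: contracting the two legs created by [D]
    amounts to contracting the original leg with that product. *)
Lemma contr_tassoc (W : vectType F) (D : V -> tensor V V) u v z
    (t : tensor V W) :
  linear D -> (forall x, w v (contr u (D x)) = w z x) ->
  contr v (contr u (tassoc (tmap D id t))) = contr z t.
Proof.
move=> lD Dz; move: t; apply: tensor_ext.
- apply: linear_comp; first exact: contr_linear.
  apply: linear_comp; first exact: contr_linear.
  by apply: (linear_comp (f := @tassoc F V V W)); apply: tlift_linear.
- exact: contr_linear.
move=> x s; rewrite tmap_tens // contr_tens -Dz.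
(* Once [w z x] is expressed through [D x], both sides are linear in that tensor, which can be
   generalised and then taken to be pure. *)
move: (D x); apply: tensor_ext.
- apply: linear_comp; first exact: contr_linear.
  apply: linear_comp; first exact: contr_linear.
  apply: (linear_comp (f := @tassoc F V V W)); first exact: tlift_linear.
  exact: (tens_bilinear _ _).1.
- by move=> a p q; rewrite (contr_linear _ a) !wE scalerDl scalerA.
move=> y y'; rewrite tassoc_tens !contr_tens (linZ (@contr_linear _ _)).
by rewrite !contr_tens !wE scalerA.
Qed.

End Contraction.

(** * Duality between special L-dendriform algebras and coalgebras *)

Section DualCoalgebra.
Variables (F : fieldType) (V : vectType F) (w : V -> V -> F).
Hypothesis w_bil : is_bilinear (w : V -> V -> F^o).

(** Non-degeneracy in its surjective form, which makes every coordinate function available as some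
    [w u]. *)
Definition represents_functionals :=
  forall f : V -> F^o, linear f -> exists u, forall x, f x = w u x.

Definition dual_to (m : V -> V -> V) (D : V -> tensor V V) :=
  forall u v x, w v (contr w u (D x)) = w (m u v) x.

Hypothesis w_rep : represents_functionals.

Lemma pairing_inj x y : (forall u, w u x = w u y) -> x = y.
Proof.
move=> wxy; rewrite (coord_vbasis (memvf x)) (coord_vbasis (memvf y)).
apply: eq_bigr => i _; congr (_ *: _).
by have [|u uP] := w_rep (f := coord (vbasis fullv) i);
  [exact: linearP | rewrite !uP].
Qed.

(** The entry [i j] of a tensor is the [j]-th coordinate of its contraction with the vector
    representing the [i]-th coordinate function. *)
Lemma contr_inj (W : vectType F) (s t : tensor V W) :
  (forall u, contr w u s = contr w u t) -> s = t.
Proof.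
move=> st; apply/matrixP => i j.
have [|u uP] := w_rep (f := coord (vbasis fullv) i); first exact: linearP.
suff E (z : tensor V W) : z i j = coord (vbasis fullv) j (contr w u z).
  by rewrite !E st.
move: z; apply: (tensor_ext (W := F^o)).
- by move=> a x y; rewrite !mxE.
- by move=> a x y; rewrite (contr_linear w u a) linearP.
by move=> x y; rewrite mxE contr_tens // linearZ /= -uP.
Qed.

Lemma tensor_pairing_inj (s t : tensor V V) :
  (forall u v, w v (contr w u s) = w v (contr w u t)) -> s = t.
Proof. by move=> st; apply: contr_inj => u; apply: pairing_inj. Qed.

Lemma dual_to_tflip m D : linear D -> dual_to m D ->
  (forall x y, m x y = - m y x) -> forall x, D x = - tflip (D x).
Proof.
move=> lD mD mN x; apply: tensor_pairing_inj => u v.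
by rewrite contrN wNr // contr_tflip // !mD mN wNl.
Qed.

(** Pairing a coalgebra axiom at [x] with three vectors [u], [v], [z] yields an identity between
    triple products of [u], [v], [z], paired with [x]. *)
Lemma dual_coalgebra (tr tl : V -> V -> V) (Delta Nabla : V -> tensor V V) :
  is_special_L_dendriform tr tl -> linear Delta -> linear Nabla ->
  dual_to tr Delta -> dual_to tl Nabla ->
  is_special_L_dendriform_coalgebra Delta Nabla.
Proof.
case=> -[tr_bil tl_bil ax1 ax2] tlN lD lN trD tlD.
pose diam x y := tr x y + tl x y; pose Diam x := Delta x + Nabla x.
have lDi : linear Diam by exact: linear_add.
have diD : dual_to diam Diam.
  by move=> u v x; rewrite contrD wDr // trD tlD wDl.
have idN D m u v z (t : tensor V V) : linear D -> dual_to m D ->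
    w z (contr w v (contr w u (tmap id D t))) = w (m v z) (contr w u t).
  by move=> lin_D mD; rewrite (contr_tmap w_bil _ _ _ (u' := u)).
have DNid D m u v (t : tensor V V) : linear D -> dual_to m D ->
    contr w v (contr w u (tassoc (tmap D id t))) = contr w (m u v) t.
  by move=> lin_D mD; apply: contr_tassoc.
have pairing3_inj (s t : tensor V (tensor V V)) : (forall u v z,
    w z (contr w v (contr w u s)) = w z (contr w v (contr w u t))) -> s = t.
  by move=> st; apply: contr_inj => u; apply: tensor_pairing_inj.
have flip u v (t : tensor V (tensor V V)) :
    contr w v (contr w u (tflip12 t)) = contr w u (contr w v t).
  exact: contr_tflip12.
split=> //; first exact: dual_to_tflip tlN.
  move=> /= x; apply: pairing3_inj => u v z.
  rewrite !(contrD, contrN, wDr w_bil, wNr w_bil) flip.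
  rewrite !(idN Nabla tl) // (idN Diam diam) // (DNid Diam diam) //.
  rewrite -/(Diam x) diD !tlD /diam !contr0 (w0r w_bil).
  (* The two copies of [tl u (tl v z)] cancel; by antisymmetry of [tl] what remains is the second
     L-dendriform axiom. *)
  have := congr1 (w^~ x) (ax2 u v z).
  rewrite (tlN v u) !(linN (tl_bil.1 _), linD (tl_bil.1 _), linD (tl_bil.2 _)).
  rewrite !(wE w_bil) (w0l w_bil) => {}ax2.
  by rewrite -[RHS]ax2; ring.
move=> /= x; apply: pairing3_inj => u v z.
rewrite !(contrN, contrD, wDr w_bil, wNr w_bil) !flip.
rewrite !(idN Diam diam) // !(DNid Diam diam) // -!/(Diam x) !diD /diam.
(* The goal is left-symmetry of [diam], which is the first axiom at [u], [v] plus the second at [u],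
   [v] minus the second at [v], [u]. *)
have := congr1 (w^~ x) (ax2 v u z); have := congr1 (w^~ x) (ax2 u v z).
have := congr1 (w^~ x) (ax1 u v z).
rewrite (tlN v u) !(linN (tl_bil.1 _), linN (tr_bil.1 _), linD (tl_bil.1 _),
  linD (tl_bil.2 _), linD (tr_bil.1 _), linD (tr_bil.2 _)).
rewrite !(wE w_bil) (w0l w_bil) => {}ax1 ax2uv ax2vu.
apply/eqP; rewrite -subr_eq0; apply/eqP.
by transitivity (0 + 0 - 0 : F); [rewrite -{1}ax1 -{1}ax2uv -ax2vu |]; ring.
Qed.

End DualCoalgebra.

(** * Bialgebras from a symplectic Lie algebra with a Rota-Baxter operator *)

Section SymplecticRotaBaxter.
Variables (F : fieldType) (V : vectType F) (br : V -> V -> V).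
Hypothesis br_bil : is_bilinear br.
Hypothesis brC : forall x y, br x y = - br y x.
Hypothesis jacobi : forall x y z, br x (br y z) = br (br x y) z + br y (br x z).

Variables P Q : V -> V.
Hypotheses (linP : linear P) (linQ : linear Q).
Hypothesis RB : forall x y, br (P x) (P y) = P (br (P x) y + br x (P y)).
Hypothesis adm :
  forall x y, br (P x) (Q y) + Q (br x (Q y)) = Q (br (P x) y).

Variable w : V -> V -> F.
Hypothesis w_bil : is_bilinear (w : V -> V -> F^o).
Hypothesis wC : forall x y, w x y = - w y x.
Hypothesis w_cocycle :
  forall x y z, w (br x y) z + w (br y z) x + w (br z x) y = 0.
Hypothesis wQP : forall x y, w (Q x) y = w x (P y).

Variable r : tensor V V.
Hypothesis contr_r : forall u, contr w u r = u.

Let brDl x y z : br (x + y) z = br x z + br y z.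
Proof. exact: (linD (br_bil.1 z)). Qed.
Let brDr x y z : br x (y + z) = br x y + br x z.
Proof. exact: (linD (br_bil.2 x)). Qed.
Let brNl x z : br (- x) z = - br x z.
Proof. exact: (linN (br_bil.1 z)). Qed.
Let brNr x z : br x (- z) = - br x z.
Proof. exact: (linN (br_bil.2 x)). Qed.
Let brE := (brDl, brDr, brNl, brNr).
Let PQE := (linD linP, linN linP, linD linQ, linN linQ).

Let delta := coboundary br r.
Let tr a b := br (P a) b + Q (br a b).
Let tl a b := - Q (br a b).
Let Delta a := tmap Q id (delta a) + delta (P a).
Let Nabla a := - delta (P a).

(** Serves to produce representing vectors: [f] is any functional, not yet known to have the form
    [w u], and for [t = r] the vector on the right represents it up to sign. *)
Lemma functional_contr_tflip (f : V -> F^o) v (t : tensor V V) : linear f ->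
  f (contr w v (tflip t)) = w v (tlift (fun x s => f x *: s) t).
Proof.
move=> lf; move: t; apply: (tensor_ext (W := F^o)).
- apply: (linear_comp lf); apply: linear_comp; first exact: contr_linear.
  exact: tlift_linear.
- apply: (linear_comp (f := w v : V -> F^o)); first exact: w_bil.2.
  exact: tlift_linear.
move=> x s; rewrite tflip_tens contr_tens // (linZ lf).
rewrite tlift_tens ?(wZr w_bil); first exact: mulrC.
split=> [z a y y'|y a z z']; first by rewrite lf scalerDl scalerA.
by rewrite scalerDr !scalerA mulrC.
Qed.

(** By [contr_r], [u] is recovered from [r] through the values [w u _] alone. *)
Lemma pairing_nondeg u : (forall v, w u v = 0) -> u = 0.
Proof.
move=> u0; rewrite -[u]contr_r /contr /tlift big1 // => i _.
by rewrite big1 // => j _; rewrite u0 scale0r scaler0.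
Qed.

(** This is the skewness of [r], inherited from that of the form it inverts. *)
Lemma contr_tflip_r v : contr w v (tflip r) = - v.
Proof.
apply/eqP; rewrite -subr_eq0 opprK; apply/eqP/pairing_nondeg => u.
by rewrite wC (wDr w_bil) contr_tflip // contr_r wC addNr oppr0.
Qed.

Lemma pairing_represents : represents_functionals w.
Proof.
move=> f lf; exists (tlift (fun x s => f x *: s) r) => v.
by rewrite wC -functional_contr_tflip // contr_tflip_r (linN lf) opprK.
Qed.

(* The left-symmetric product of a symplectic Lie algebra: contracting [r]
   against a functional gives the vector that represents it, and the sign
   inside comes from [contr_tflip_r]. *)
Definition star u v := tlift (fun x s => w v (br u (- x)) *: s) r.

Lemma starE u v z : w (star u v) z = - w v (br u z).
Proof.
rewrite /star wC -(functional_contr_tflip (f := fun x => w v (br u (- x)))).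
  by rewrite contr_tflip_r opprK.
by move=> a x y; rewrite opprD -scalerN br_bil.2; apply: w_bil.2.
Qed.

(** The transpose of [adm]: pairing with [z] turns [star] into the bracket and [P] into [Q]. *)
Lemma star_RB x u : star (P x) (P u) = P (star (P x) u + star x (P u)).
Proof.
apply/eqP; rewrite -subr_eq0; apply/eqP/pairing_nondeg => z.
have wPQ a b : w (P a) b = w a (Q b) by rewrite wC -wQP -wC.
by rewrite !(wE w_bil) wPQ !(wE w_bil) !starE !wPQ -adm !(wE w_bil); ring.
Qed.

(** Where [br a] acts on the second leg of [r] it comes out of the contraction; on the first leg it
    passes to [u] as its transpose [- star a]. *)
Lemma contr_coboundary u a : contr w u (delta a) = br a u - star a u.
Proof.
have lid := @linear_id F V.
rewrite /delta /coboundary contrD (contr_tmap (u' := - star a u) w_bil) //.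
- rewrite (contr_tmap (u' := u) w_bil) // ?contr_r 1?addrC //.
  exact: br_bil.2.
- exact: br_bil.2.
by move=> x; rewrite (wNl w_bil) starE opprK.
Qed.

Lemma pairing_br u v a : w (br u v) a = w v (br a u) - w u (br a v).
Proof.
apply/eqP; rewrite -subr_eq0 -(w_cocycle u v a) (wC (br v a)) (brC v a).
by rewrite (wC (br a u)) (wNr w_bil); apply/eqP; ring.
Qed.

Lemma dual_to_coboundary : dual_to w br delta.
Proof.
move=> u v a; rewrite contr_coboundary pairing_br !(wE w_bil).
by rewrite (wC v (star a u)) starE opprK.
Qed.

(* [delta] is a 1-cocycle: dually, delta [a, y] = a . delta y - y . delta a.
   The three bialgebra axioms all reduce to this identity. *)
Lemma coboundary_cocycle b v a y :
  w (br b v) (br a y) =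
  w (br (star y b) v + br b (star y v)) a -
  w (br (star a b) v + br b (star a v)) y.
Proof.
have sE c d z : w c (br d z) = - w (star d c) z by rewrite starE opprK.
rewrite !(wE w_bil) !pairing_br !starE (sE v a (star y b)).
rewrite (sE b a (star y v)) (sE v y (star a b)) (sE b y (star a v)).
(* Pairings of two [star] terms cancel by skewness of [w], and the double brackets by Jacobi. *)
rewrite (wC (star a v)) (wC (star a b)) (jacobi a y v) (jacobi a y b).
by rewrite !(wE w_bil); ring.
Qed.

Let diam a b := tr a b + tl a b.
Let Diam a := Delta a + Nabla a.

(** The [Q] terms cancel, leaving the pre-Lie product that a Rota-Baxter operator of weight zero
    induces on a Lie algebra. *)
Let diamE a b : diam a b = br (P a) b.
Proof. exact: addrK. Qed.

Let DiamE a : Diam a = tmap Q id (delta a).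
Proof. exact: addrK. Qed.

Let wPQ x y : w x (Q y) = w (P x) y.
Proof. by rewrite wC wQP -wC. Qed.

(** Linearity is read off from the dual description, where [a] occurs only as an argument of [w]. *)
Lemma linear_delta : linear delta.
Proof.
move=> a x y; apply: (tensor_pairing_inj w_bil pairing_represents) => u v.
rewrite (contr_linear w u a) !(wDr w_bil, wZr w_bil) !dual_to_coboundary.
by rewrite !(wDr w_bil, wZr w_bil).
Qed.

Lemma pairing_tmap (f g : V -> V) u' v' u v t : linear f -> linear g ->
    (forall x, w u (f x) = w u' x) -> (forall x, w v (g x) = w v' x) ->
  w v (contr w u (tmap f g t)) = w v' (contr w u' t).
Proof. by move=> lf lg fu gv; rewrite (contr_tmap w_bil _ lf lg fu) gv. Qed.

Lemma dual_to_Nabla : dual_to w tl Nabla.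
Proof.
move=> u v a; rewrite contrN (wNr w_bil) dual_to_coboundary /tl (wNl w_bil).
by rewrite wQP.
Qed.

Lemma dual_to_Diam : dual_to w diam Diam.
Proof.
move=> u v a; rewrite DiamE diamE (pairing_tmap (u' := P u) (v' := v)) //.
exact: dual_to_coboundary.
Qed.

Lemma dual_to_Delta : dual_to w tr Delta.
Proof.
move=> u v a; rewrite -[Delta a](addrK (Nabla a)) contrD contrN.
by rewrite (wDr w_bil) (wNr w_bil) dual_to_Diam dual_to_Nabla wDl // addrK.
Qed.

(** The first axiom combines the Rota-Baxter identity, [adm] and Jacobi; the second comes from [adm]
    and Jacobi. *)
Lemma symplectic_special_L_dendriform : is_special_L_dendriform tr tl.
Proof.
have tlN x y : tl x y = - tl y x by rewrite /tl brC PQE.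
have admE x y : br (P x) (Q y) = Q (br (P x) y) - Q (br x (Q y)).
  by rewrite -adm addrK.
have RBE x y : P (br (P x) y) = br (P x) (P y) - P (br x (P y)).
  by rewrite RB (linD linP) addrK.
split=> //; split.
- split=> [z a x y|x a y z]; rewrite /tr.
    by rewrite linP !br_bil.1 linQ scalerDr addrACA.
  by rewrite !br_bil.2 linQ scalerDr addrACA.
- split=> [z a x y|x a y z]; rewrite /tl.
    by rewrite br_bil.1 linQ opprD scalerN.
  by rewrite br_bil.2 linQ opprD scalerN.
(* Pairing with an arbitrary [c] moves the identity into the field, where [ring] applies. *)
- move=> x y z; apply: pairing_nondeg => c; rewrite /tr /tl.
  rewrite (brC y x) (brC (P y) x) !(brE, PQE) (admE x (br y z)).
  rewrite (admE y (br x z)) RBE (jacobi (P x) (P y)) (jacobi (P x) y).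
  rewrite (jacobi (P y) x) (brC (P y) x).
  by rewrite !(brE, PQE) !(wE w_bil); ring.
move=> x y z; apply: pairing_nondeg => c; rewrite /tr /tl.
rewrite (brC y x) !(brE, PQE) (admE x (br y z)) (jacobi (P x) y).
by rewrite !(brE, PQE) !(wE w_bil); ring.
Qed.

Lemma symplectic_Rota_Baxter_bialgebra :
  is_special_L_dendriform_bialgebra tr tl Delta Nabla.
Proof.
have lNabla : linear Nabla.
  by apply/linear_opp/(linear_comp linear_delta).
have lDelta : linear Delta.
  apply: linear_add; last exact: linear_comp linear_delta linP.
  by apply: linear_comp linear_delta; apply: tlift_linear.
have [[tr_bil tl_bil _ _] tlN] := symplectic_special_L_dendriform.
(* The [w]-transposes of the multiplication operators; they carry every operator in the axioms over
   to the test vectors [u] and [v]. *)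
have adj_diam y v z : w v (diam y z) = w (- star (P y) v) z.
  by rewrite diamE (wNl w_bil) starE opprK.
have adj_diamr y v z : w v (diam z y) = w (Q (star y v)) z.
  by rewrite diamE wQP starE brC (wNr w_bil).
have adj_tl y u z : w u (tl y z) = w (star y (P u)) z.
  by rewrite (wNr w_bil) wPQ starE.
(* The sum inside is exactly the argument of [P] in [star_RB]. *)
have adj_tr x u z :
    w u (tr x z) = w (- (star (P x) u + star x (P u))) z.
  by rewrite (wDr w_bil) wPQ (wNl w_bil) (wDl w_bil) !starE opprD !opprK.
have lid := @linear_id F V.
have pairD u v (s t : tensor V V) :
    w v (contr w u (s + t)) = w v (contr w u s) + w v (contr w u t).
  by rewrite contrD (wDr w_bil).
have pairB u v (s t : tensor V V) :
    w v (contr w u (s - t)) = w v (contr w u s) - w v (contr w u t).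
  by rewrite pairD contrN (wNr w_bil).
have pairBB u v (s t t' : tensor V V) : w v (contr w u (s - t - t')) =
    w v (contr w u s) - w v (contr w u t) - w v (contr w u t').
  by rewrite !pairB.
have ldiam x : linear (diam x) by move=> a y z; rewrite !diamE br_bil.2.
have ldiamr x : linear (diam^~ x).
  by move=> a y z; rewrite !diamE linP br_bil.1.
split.
- exact: symplectic_special_L_dendriform.
- exact: (dual_coalgebra w_bil pairing_represents
    symplectic_special_L_dendriform lDelta lNabla dual_to_Delta dual_to_Nabla).
- move=> /= x y; apply: (tensor_pairing_inj w_bil pairing_represents) => u v.
  rewrite -/(diam x y) -/(Diam x) -/(Diam y) -/(Diam (diam x y)).
  rewrite contr0 (w0r w_bil) pairB pairD pairB (pairD _ _ (tmap (tr x) id _)).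
  rewrite dual_to_Diam.
  rewrite (pairing_tmap (u' := u) _ lid (ldiamr y) _ (adj_diamr y v)) //.
  rewrite (pairing_tmap (v' := v) _ (tl_bil.2 y) lid (adj_tl y u)) //.
  rewrite (pairing_tmap (v' := v) _ (tr_bil.2 x) lid (adj_tr x u)) //.
  rewrite (pairing_tmap (u' := u) _ lid (ldiam x) _ (adj_diam x v)) //.
  (* [adm] merges the two terms of [tr u (Q _)] into one, and [star_RB] does the same for the
     transpose of [tr x]. The result is the cocycle identity at [P u], [v], [P x], [y]. *)
  rewrite dual_to_Delta dual_to_Nabla !dual_to_Diam !diamE /tr adm /tl.
  rewrite (linN linP) -star_RB coboundary_cocycle !brE.
  by rewrite !(wE w_bil) !wQP; ring.
- move=> /= x y; apply: (tensor_pairing_inj w_bil pairing_represents) => u v.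
  rewrite -/(Diam x) -/(Diam y) -/(Diam (tl x y)).
  rewrite contr0 (w0r w_bil) pairB contr_tflip //.
  rewrite (pairBB v u) (pairBB u v).
  rewrite (pairing_tmap (u' := u) _ lid (tl_bil.2 x) _ (adj_tl x v)) //.
  rewrite (pairing_tmap (u' := v) _ lid (tl_bil.2 x) _ (adj_tl x u)) //.
  rewrite (pairing_tmap (u' := u) _ lid (tl_bil.2 y) _ (adj_tl y v)) //.
  rewrite (pairing_tmap (u' := v) _ lid (tl_bil.2 y) _ (adj_tl y u)) //.
  rewrite !dual_to_Diam !diamE /tl !(wNr w_bil) !wPQ.
  (* Subtracting the flipped tensor leaves [br (P v) (P u)] paired with [br x y], to which the
     cocycle identity applies. *)
  have -> : P (br (P v) u) = br (P v) (P u) + P (br (P u) v).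
    by rewrite RB (brC v (P u)) -(linD linP) subrK.
  rewrite !(wDl w_bil) coboundary_cocycle.
  rewrite (brC (star y (P v)) (P u)) (brC (star x (P v)) (P u)).
  by rewrite !(wE w_bil); ring.
move=> /= x y; apply: (tensor_pairing_inj w_bil pairing_represents) => u v.
rewrite -/(diam x y) -/(diam y x).
rewrite contr0 (w0r w_bil) pairB !pairD.
rewrite (pairing_tmap (v' := v) _ (ldiam y) lid (adj_diam y u)) //.
rewrite (pairing_tmap (v' := v) _ (ldiam x) lid (adj_diam x u)) //.
rewrite (pairing_tmap (u' := u) _ lid (ldiam y) _ (adj_diam y v)) //.
rewrite (pairing_tmap (u' := u) _ lid (ldiam x) _ (adj_diam x v)) //.
(* [P] maps the commutator of [diam] to [br (P x) (P y)], so the cocycle identity is used at [P x]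
   and [P y]. *)
rewrite !dual_to_Nabla !diamE /tl !(wNl w_bil) !wQP (brC (P y) x) opprK -RB.
rewrite coboundary_cocycle !brE.
by rewrite !(wE w_bil); ring.
Qed.

End SymplecticRotaBaxter.

(** * The symplectic structure on the semidirect product and its operators *)

Section SemidirectProduct.
Variables (F : fieldType) (A : vectType F) (circ : A -> A -> A) (P : 'End(A)).
Hypothesis circ_pre_Lie : is_pre_Lie circ.
Hypothesis circ_RB :
  forall x y, circ (P x) (P y) = P (circ (P x) y) + P (circ x (P y)).

Let V : vectType F := semidirect A.
Let br : V -> V -> V := semidirect_bracket circ.

Let circ_bil : is_bilinear circ := pre_Lie_bilinear circ_pre_Lie.
Let preLie x y z :
  circ x (circ y z) = circ (circ x y) z - circ (circ y x) z + circ y (circ x z).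
Proof.
rewrite -[LHS](subKr (circ (circ x y) z)) (pre_Lie_axiom circ_pre_Lie x y z).
by rewrite opprB addrA addrAC.
Qed.

Let circDl x y z : circ (x + y) z = circ x z + circ y z.
Proof. exact: (linD (circ_bil.1 z)). Qed.
Let circDr x y z : circ x (y + z) = circ x y + circ x z.
Proof. exact: (linD (circ_bil.2 x)). Qed.
Let circNl x z : circ (- x) z = - circ x z.
Proof. exact: (linN (circ_bil.1 z)). Qed.
Let circNr x z : circ x (- z) = - circ x z.
Proof. exact: (linN (circ_bil.2 x)). Qed.
Let circ0l z : circ 0 z = 0.
Proof. exact: (lin0 (circ_bil.1 z)). Qed.
Let circ0r z : circ z 0 = 0.
Proof. exact: (lin0 (circ_bil.2 z)). Qed.
Let circZl k x z : circ (k *: x) z = k *: circ x z.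
Proof. exact: (linZ (circ_bil.1 z)). Qed.
Let circZr k x z : circ x (k *: z) = k *: circ x z.
Proof. exact: (linZ (circ_bil.2 x)). Qed.
Let circE :=
  (circDl, circDr, circNl, circNr, circ0l, circ0r, circZl, circZr).

Definition symplectic_form (u v : V) : F := u.2 v.1 - v.2 u.1.

Lemma dual_separates (x y : A) : (forall f : dual_space A, f x = f y) -> x = y.
Proof.
move=> fxy; rewrite (coord_vbasis (memvf x)) (coord_vbasis (memvf y)).
apply: eq_bigr => i _; congr (_ *: _).
have := fxy (linfun (coord (vbasis fullv) i : A -> F^o)).
by rewrite !(lfunE (coord (vbasis fullv) i : {linear A -> F^o})).
Qed.

(** Testing vectors on functionals and functionals on vectors makes identities in [V] accessible to
    [ring]. *)
Lemma semidirect_ext (u v : V) : (forall f : dual_space A, f u.1 = f v.1) ->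
  (forall z, u.2 z = v.2 z) -> u = v.
Proof.
case: u v => [x a] [y b] /= /dual_separates -> ab.
by congr (_, _); apply/lfunP.
Qed.

Lemma transposeE (a : dual_space A) z : transpose P a z = a (P z).
Proof. by rewrite /transpose comp_lfunE. Qed.

Let dualD (a b : dual_space A) z : (a + b) z = a z + b z.
Proof. exact: add_lfunE. Qed.
Let dualN (a : dual_space A) z : (- a) z = - a z.
Proof. exact: opp_lfunE. Qed.
Let dual0 z : (0 : dual_space A) z = 0.
Proof. exact: zero_lfunE. Qed.
Let dual_argD (a : dual_space A) x y : a (x + y) = a x + a y.
Proof. exact: linearD. Qed.
Let dual_argN (a : dual_space A) x : a (- x) = - a x.
Proof. exact: linearN. Qed.
Let dual_arg0 (a : dual_space A) : a 0 = 0.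
Proof. exact: linear0. Qed.
Let dualZ k (a : dual_space A) z : (k *: a) z = k * a z.
Proof. exact: scale_lfunE. Qed.
Let dual_argZ k (a : dual_space A) x : a (k *: x) = k * a x.
Proof. exact: linearZ. Qed.
Let LstarE' x a y := @LstarE _ _ circ x a y circ_bil.
Let dualE := (LstarE', transposeE, dualD, dualN, dual0,
  dual_argD, dual_argN, dual_arg0, dualZ, dual_argZ).
Let PD x y : P (x + y) = P x + P y.
Proof. exact: linearD. Qed.
Let PN x : P (- x) = - P x.
Proof. exact: linearN. Qed.
Let P0 : P 0 = 0.
Proof. exact: linear0. Qed.
Let PZ k x : P (k *: x) = k *: P x.
Proof. exact: linearZ. Qed.
Let PE := (PD, PN, P0, PZ).

Lemma symplectic_form_bilinear :
  is_bilinear (symplectic_form : V -> V -> F^o).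
Proof.
split=> [[y b] k [x a] [x' a']|[x a] k [y b] [y' b']];
  rewrite /symplectic_form /= !(linearP, add_lfunE, scale_lfunE) /=;
  rewrite /GRing.scale /=; ring.
Qed.

Lemma symplectic_formC u v : symplectic_form u v = - symplectic_form v u.
Proof. by rewrite opprB. Qed.

Lemma semidirect_bracketC u v : br u v = - br v u.
Proof. by congr (_, _); rewrite opprB. Qed.

Lemma semidirect_bracket_bilinear : is_bilinear br.
Proof.
have brlin v : linear (br^~ v).
  by move=> k u u'; apply: semidirect_ext => [f|z] /=;
    rewrite /sub_adjacent !(dualE, circE); ring.
split=> // u k v v'.
by rewrite semidirect_bracketC brlin opprD -scalerN -!semidirect_bracketC.
Qed.

(** On [A] this is Jacobi for the commutator; on the dual it says that [Lstar] is a representation.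
    Both come from left-symmetry. *)
Lemma semidirect_jacobi u v t : br u (br v t) = br (br u v) t + br v (br u t).
Proof.
case: u v t => [x a] [y b] [z c]; apply: semidirect_ext => [f|t] /=.
  rewrite /sub_adjacent !circE (preLie x y z) (preLie x z y) (preLie y z x).
  by rewrite !dualE; ring.
rewrite /sub_adjacent !(dualE, circE).
by rewrite (preLie x y t) (preLie x z t) (preLie y z t) !dualE; ring.
Qed.

(** In the cyclic sum each commutator term cancels against a term coming from [Lstar], and the
    remaining [Lstar] terms are accounted for in the same way. *)
Lemma symplectic_form_cocycle u v t : symplectic_form (br u v) t
  + symplectic_form (br v t) u + symplectic_form (br t u) v = 0.
Proof.
case: u v t => [x a] [y b] [z c].
by rewrite /symplectic_form /= /sub_adjacent !dualE; ring.
Qed.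

Lemma ext_P_adjoint u v :
  symplectic_form (ext_Pstar P u) v = symplectic_form u (ext_P P v).
Proof.
by case: u v => [x a] [y b]; rewrite /symplectic_form /= !dualE; ring.
Qed.

Lemma ext_PmPstar_adjoint u v :
  symplectic_form (ext_mPpPstar P u) v = symplectic_form u (ext_PmPstar P v).
Proof.
by case: u v => [x a] [y b]; rewrite /symplectic_form /= !dualE; ring.
Qed.

Lemma ext_P_linear : linear (ext_P P : V -> V).
Proof.
by move=> k [x a] [y b]; apply: semidirect_ext => [f|t] /=;
  rewrite !(PE, dualE); ring.
Qed.

Lemma ext_Pstar_linear : linear (ext_Pstar P : V -> V).
Proof.
by move=> k [x a] [y b]; apply: semidirect_ext => [f|t] /=;
  rewrite !(PE, dualE); ring.
Qed.

Lemma ext_PmPstar_linear : linear (ext_PmPstar P : V -> V).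
Proof.
by move=> k [x a] [y b]; apply: semidirect_ext => [f|t] /=;
  rewrite !(PE, dualE); ring.
Qed.

Lemma ext_mPpPstar_linear : linear (ext_mPpPstar P : V -> V).
Proof.
by move=> k [x a] [y b]; apply: semidirect_ext => [f|t] /=;
  rewrite !(PE, dualE); ring.
Qed.

Lemma ext_P_RB u v :
  br (ext_P P u) (ext_P P v) = ext_P P (br (ext_P P u) v + br u (ext_P P v)).
Proof.
case: u v => [x a] [y b]; apply: semidirect_ext => [f|t] /=.
  by rewrite /sub_adjacent !circ_RB !PE !dualE; ring.
by rewrite !dualE; ring.
Qed.

(** The dual component, evaluated at [t], is a functional applied to the Rota-Baxter identity of
    [circ] itself, not merely of its commutator. *)
Lemma ext_P_adm u v :
  br (ext_P P u) (ext_Pstar P v) + ext_Pstar P (br u (ext_Pstar P v)) =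
  ext_Pstar P (br (ext_P P u) v).
Proof.
case: u v => [x a] [y b]; apply: semidirect_ext => [f|t] /=.
  by rewrite /sub_adjacent !circE !dualE; ring.
by rewrite !(dualE, circE) circ_RB !dualE; ring.
Qed.

Lemma ext_PmPstar_RB u v :
  br (ext_PmPstar P u) (ext_PmPstar P v) =
  ext_PmPstar P (br (ext_PmPstar P u) v + br u (ext_PmPstar P v)).
Proof.
case: u v => [x a] [y b]; apply: semidirect_ext => [f|t] /=.
  by rewrite /sub_adjacent !circ_RB !PE !dualE; ring.
by rewrite !dualE !circ_RB !dualE; ring.
Qed.

(** Since [ext_mPpPstar P] is the negative of [ext_PmPstar P], this is a rearranged form of the
    Rota-Baxter identity. *)
Lemma ext_PmPstar_adm u v :
  br (ext_PmPstar P u) (ext_mPpPstar P v)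
  + ext_mPpPstar P (br u (ext_mPpPstar P v)) =
  ext_mPpPstar P (br (ext_PmPstar P u) v).
Proof.
case: u v => [x a] [y b]; apply: semidirect_ext => [f|t] /=.
  by rewrite /sub_adjacent !circE !circ_RB !PE !dualE; ring.
by rewrite !(dualE, circE) !circ_RB !dualE; ring.
Qed.

(** The two halves of [r] give the expansions of the dual part and of the vector part of [u] in the
    dual basis and in [e]. *)
Lemma contr_canonical_r n (e : n.-tuple A) (u : V) : basis_of fullv e ->
  contr symplectic_form u (canonical_r e) = u.
Proof.
move=> be; have w_bil := symplectic_form_bilinear.
have dbE i x : dual_basis e i x = coord e i x.
  exact: (lfunE (coord e i : {linear A -> F^o})).
rewrite /canonical_r (big_morph _ (contrD _ u) (contr0 _ _ u)).
under eq_bigr => i _ do rewrite contrD contrN !contr_tens //.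
case: u => x a; apply: semidirect_ext => [f|z].
  rewrite (big_morph (fun v : V => v.1) (fun _ _ => erefl) erefl) /=.
  congr (f _); rewrite [in RHS](coord_basis be (memvf x)).
  apply: eq_bigr => i _.
  rewrite /symplectic_form /= !dualE dbE (tnth_nth 0) scaler0 !add0r.
  by rewrite scaleNr opprK.
rewrite (big_morph (fun v : V => v.2) (fun _ _ => erefl) erefl) /=.
rewrite sum_lfunE [in RHS](coord_basis be (memvf z)) linear_sum.
apply: eq_bigr => i _.
by rewrite /symplectic_form /= !dualE dbE (tnth_nth 0) subr0 mulr0 subr0 mulrC.
Qed.

End SemidirectProduct.

(** * The two bialgebras, from the two pairs of operators *)

Theorem corollary4p27 (F : fieldType) (charF : [pchar F] =i pred0)
    (A : vectType F) (circ : A -> A -> A) (P : 'End(A))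
    (RB : is_Rota_Baxter_pre_Lie circ P)
    (n : nat) (e : n.-tuple A) (basis_e : basis_of fullv e) :
  let V : vectType F := semidirect A in
  let br : V -> V -> V := semidirect_bracket circ in
  let delta : V -> tensor V V := coboundary br (canonical_r e) in
  let Q : V -> V := ext_PmPstar P in
  let mQ : V -> V := ext_mPpPstar P in
  let P0 : V -> V := ext_P P in
  let Pstar : V -> V := ext_Pstar P in
  let tl1 (a b : V) : V := - mQ (br a b) in
  let tr1 (a b : V) : V := br (Q a) b + mQ (br a b) in
  let Nabla1 (a : V) : tensor V V := - delta (Q a) in
  let Delta1 (a : V) : tensor V V := tmap mQ id (delta a) + delta (Q a) in
  let tl2 (a b : V) : V := - Pstar (br a b) in
  let tr2 (a b : V) : V := br (P0 a) b + Pstar (br a b) in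
  let Nabla2 (a : V) : tensor V V := - delta (P0 a) in
  let Delta2 (a : V) : tensor V V := tmap Pstar id (delta a) + delta (P0 a) in
  is_special_L_dendriform_bialgebra tr1 tl1 Delta1 Nabla1 /\
  is_special_L_dendriform_bialgebra tr2 tl2 Delta2 Nabla2.
Proof.
have [preLie circ_RB] := RB.
have contr_r := fun u => contr_canonical_r u basis_e.
have br_bil := semidirect_bracket_bilinear preLie.
have jacobi := semidirect_jacobi preLie.
have cocycle := symplectic_form_cocycle preLie.
split.
  exact: (symplectic_Rota_Baxter_bialgebra br_bil (semidirect_bracketC circ)
    jacobi (ext_PmPstar_linear P) (ext_mPpPstar_linear P)
    (ext_PmPstar_RB preLie circ_RB) (ext_PmPstar_adm preLie circ_RB)
    (@symplectic_form_bilinear F A) (@symplectic_formC F A) cocycle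
    (ext_PmPstar_adjoint P) contr_r).
exact: (symplectic_Rota_Baxter_bialgebra br_bil (semidirect_bracketC circ)
  jacobi (ext_P_linear P) (ext_Pstar_linear P) (ext_P_RB preLie circ_RB)
  (ext_P_adm preLie circ_RB) (@symplectic_form_bilinear F A)
  (@symplectic_formC F A) cocycle (ext_P_adjoint P) contr_r).
Qed.
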